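(* Let $m\geq n$, $A\in\mathbb{R}^{m\times n}$, $B\in\mathbb{R}^{n\times m}$, and $C\in\mathbb{R}^{m\times m}$. Assume that there exists a matrix $S\in\mathbb{R}^{m\times m}$ such that $B^{\mathrm{T}}=SA$ and $\Lambda(S)$ is reciprocal free. Then the T-congruence Sylvester equation $$AX+X^{\mathrm{T}}B=C$$ in the unknown $X\in\mathbb{R}^{n\times m}$ is equivalent to the generalized Sylvester equation $$AX-B^{\mathrm{T}}XS^{\mathrm{T}}=C-(SC)^{\mathrm{T}},$$ i.e., a matrix $X\in\mathbb{R}^{n\times m}$ satisfies the first equation if and only if it satisfies the second.
   Context: $M^{\mathrm{T}}$ denotes the transpose of $M$. For a square matrix $S\in\mathbb{R}^{m\times m}$, $\Lambda(S)$ denotes its spectrum, i.e., the set of (complex) eigenvalues of $S$. A set $\{\lambda_1,\ldots,\lambda_k\}\subset\mathbb{C}\cup\{\infty\}$ is said to be reciprocal free if $\lambda_i\neq \frac{1}{\lambda_j}$ for any $1\leq i,j\leq k$ (the case $i=j$ is included; the values $0$ and $\infty$ are admitted as elements, with $1/0=\infty$ and $1/\infty=0$). In particular, for the spectrum of a matrix $S$, reciprocal free means that $\lambda\mu\neq 1$ for all $\lambda,\mu\in\Lambda(S)$, including $\lambda=\mu$. *)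

(* Defs.v *)
From HB Require Import structures.
From mathcomp Require Import all_boot all_order all_algebra.
From mathcomp Require Import complex.
From mathcomp Require Import classical_sets reals.

Set Implicit Arguments.
Unset Strict Implicit.
Unset Printing Implicit Defensive.

Import GRing.Theory.

Local Open Scope classical_set_scope.
Local Open Scope ring_scope.

(* [option F] stands for F with a point at infinity added, [None] being the
   point at infinity; hence 1/0 = oo and 1/oo = 0. *)
Definition ext_inv (F : fieldType) (x : option F) : option F :=
  match x with
  | None => Some 0
  | Some z => if z == 0 then None else Some z^-1
  end.

(* The two elements are not required to be distinct. *)
Definition reciprocal_free (F : fieldType) (L : set (option F)) : Prop :=
  forall x y, L x -> L y -> x <> ext_inv y.

(* [eigenvalue] refers to row eigenvectors; a square matrix has the same
   eigenvalues as its transpose. *)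
Definition spectrum (R : realType) (m : nat) (S : 'M[R]_m) : set R[i] :=
  [set z | eigenvalue (map_mx (real_complex R) S) z].

(* Main.v *)
Require Import Defs.
From mathcomp Require Import all_boot all_order all_algebra.
From mathcomp Require Import complex.
From mathcomp Require Import classical_sets reals.

Local Open Scope classical_set_scope.
Local Open Scope ring_scope.

(** Let E := AX + X^T B - C be the residual of the first equation.  Since
    B^T = SA, the residual of the second equation is E - (SE)^T, which settles
    one direction.  Conversely, E = (SE)^T also reads E^T = SE, so that
    E = E^T S^T = S E S^T: the residual solves a homogeneous Stein equation.
    Such an equation E = S E T has only the zero solution when no eigenvalue
    of S is the inverse of an eigenvalue of T ([stein_eq0]).

    For the last point, a solution with E T = a E satisfies E = a S E, so if
    it were nonzero then a would be nonzero, its nonzero rows would be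
    eigenvectors of T for a, and its nonzero columns eigenvectors of S for
    a^-1, which is excluded ([stein_eigen_eq0]).  In general, the solution
    space is stable under right multiplication by T, and by the Cayley-Hamilton
    theorem E is killed by the product of the T - a_i, with a_i the roots of
    the characteristic polynomial of T over the complex numbers; the factors
    are peeled off one at a time. *)

Import GRing.Theory.

Lemma eigenvalue_trmx {F : fieldType} {n : nat} (M : 'M[F]_n) (a : F) :
  eigenvalue M^T a = eigenvalue M a.
Proof.
rewrite !eigenvalue_root_char; congr (root _ _).
by rewrite /char_poly /char_poly_mx -map_trmx -[in LHS]tr_scalar_mx -linearB /= det_tr.
Qed.

Lemma stein_eigen_eq0 {F : fieldType} {p q : nat} {S : 'M[F]_p} {T : 'M[F]_q}
    {E : 'M[F]_(p, q)} {a : F} :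
  (forall x y, eigenvalue S x -> eigenvalue T y -> x * y != 1) ->
  E = S *m E *m T -> E *m T = a *: E -> E = 0.
Proof.
move=> ST1 ESET ETa; apply/eqP; apply: contraT => E_neq0.
have EaSE : E = a *: (S *m E) by rewrite {1}ESET -mulmxA ETa scalemxAr.
have a_neq0 : a != 0.
  by apply: contraNneq E_neq0 => a0; rewrite EaSE a0 scale0r.
have [i rowE_neq0] : exists i, row i E != 0.
  apply/existsP; apply: contraNT E_neq0 => /existsPn rowE0.
  by apply/eqP/row_matrixP => i; rewrite row0; apply/eqP/negPn/rowE0.
have [j colE_neq0] : exists j, row j E^T != 0.
  apply/existsP; apply: contraNT E_neq0 => /existsPn colE0.
  rewrite -trmx_eq0; apply/eqP/row_matrixP => j.
  by rewrite row0; apply/eqP/negPn/colE0.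
have Ta : eigenvalue T a.
  by apply/eigenvalueP; exists (row i E); rewrite // -row_mul ETa linearZ.
(* The columns of E are the rows of E^T, hence the detour through S^T. *)
have SVa : eigenvalue S a^-1.
  rewrite -eigenvalue_trmx; apply/eigenvalueP; exists (row j E^T) => //.
  by rewrite -row_mul -trmx_mul {2}EaSE !linearZ /= scalerA mulfV ?scale1r.
by have := ST1 _ _ SVa Ta; rewrite mulVf ?eqxx.
Qed.

(** When the characteristic polynomial of T splits and s lists its roots, the
    last hypothesis holds for every E. *)
Lemma stein_prod_eq0 {F : fieldType} {p q : nat} {S : 'M[F]_p}
    {T : 'M[F]_q.+1} (s : seq F) (E : 'M[F]_(p, q.+1)) :
  (forall x y, eigenvalue S x -> eigenvalue T y -> x * y != 1) ->
  E = S *m E *m T -> E *m \prod_(a <- s) (T - a%:M) = 0 -> E = 0.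
Proof.
move=> ST1; elim: s E => [|a s IHs] E ESET.
  by rewrite big_nil mulmx1.
rewrite big_cons mulmxA => Es0.
(* E (T - a) is again a solution, so the induction hypothesis makes it 0. *)
apply: (stein_eigen_eq0 (a := a) ST1 ESET).
apply/eqP; rewrite -subr_eq0 -mul_mx_scalar -mulmxBr; apply/eqP/IHs => //.
by rewrite mulmxBr mul_mx_scalar mulmxBr mulmxBl -scalemxAr -scalemxAl
  mulmxA -ESET.
Qed.

(** Uniqueness for the Stein equation over an algebraically closed field. *)
Lemma stein_eq0 {F : closedFieldType} {p q : nat} {S : 'M[F]_p} {T : 'M[F]_q}
    {E : 'M[F]_(p, q)} :
  (forall x y, eigenvalue S x -> eigenvalue T y -> x * y != 1) ->
  E = S *m E *m T -> E = 0.
Proof.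
case: q T E => [|q] T E ST1 ESET; first exact: thinmx0.
have [s char_s] := closed_field_poly_normal (char_poly T).
apply: (stein_prod_eq0 s E ST1 ESET).
have := Cayley_Hamilton T.
rewrite char_s (monicP (char_poly_monic T)) scale1r rmorph_prod.
under eq_bigr do rewrite rmorphB /= horner_mx_X horner_mx_C.
by move=> ->; rewrite mulmx0.
Qed.

Lemma reciprocal_free_mul_neq1 {R : realType} {m : nat} {S : 'M[R]_m}
    {x y : R[i]} :
  reciprocal_free [set Some z | z in spectrum S] ->
  spectrum S x -> spectrum S y -> x * y != 1.
Proof.
move=> S_rf Sx Sy; apply/eqP => xy1.
apply: (S_rf (Some x) (Some y)); [by exists x | by exists y |].
have y_neq0 : y != 0.
  by apply: contra_eq_neq xy1 => ->; rewrite mulr0 eq_sym oner_neq0.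
by rewrite /= (negPf y_neq0) -[x](mulfK y_neq0) xy1 mul1r.
Qed.

Theorem theorem6 (R : realType) (m n : nat) (le_n_m : (n <= m)%N)
    (A : 'M[R]_(m, n)) (B : 'M[R]_(n, m)) (C : 'M[R]_m) (S : 'M[R]_m)
    (B_eq : B^T = S *m A)
    (S_rf : reciprocal_free [set Some z | z in spectrum S]) :
  forall X : 'M[R]_(n, m),
    A *m X + X^T *m B = C <->
    A *m X - B^T *m X *m S^T = C - (S *m C)^T.
Proof.
move=> X; pose E := A *m X + X^T *m B - C.
have resE : (A *m X - B^T *m X *m S^T) - (C - (S *m C)^T) = E - (S *m E)^T.
  have SXB : (S *m X^T *m B)^T = B^T *m X *m S^T.
    by rewrite !trmx_mul trmxK mulmxA.
  have -> : (S *m E)^T = B^T *m X *m S^T - (S *m C)^T + X^T *m B.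
    rewrite /E mulmxBr mulmxDr !mulmxA -B_eq.
    by rewrite raddfB raddfD /= SXB trmx_mul trmxK [X^T *m B + _]addrC addrAC.
  rewrite /E [A *m X + _ - C]addrAC [in RHS]opprD [RHS]addrACA subrr addr0.
  by rewrite !opprB addrACA [RHS]addrACA [- C - _]addrC.
split=> [eq1|eq2].
  have E0 : E = 0 by rewrite /E eq1 subrr.
  by apply/eqP; rewrite -subr_eq0 resE E0 mulmx0 trmx0 subrr.
have /eqP : E - (S *m E)^T = 0 by rewrite -resE eq2 subrr.
rewrite subr_eq0 => /eqP E_SE.
have E_stein : E = S *m E *m S^T.
  by rewrite {1}E_SE trmx_mul {1}E_SE trmxK.
suff E0 : E = 0 by apply/eqP; rewrite -subr_eq0 -/E E0.
(* The spectrum consists of complex numbers: pass to the complexification. *)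
apply: (map_mx_inj (f := real_complex R)); rewrite map_mx0.
apply: (stein_eq0 (S := map_mx (real_complex R) S)
  (T := (map_mx (real_complex R) S)^T)); last first.
  by rewrite {1}E_stein !map_mxM map_trmx.
move=> x y Sx; rewrite eigenvalue_trmx => Sy.
exact: reciprocal_free_mul_neq1 S_rf Sx Sy.
Qed.
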